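(* Let $\mathfrak{S}$ be a unique factorization semidomain (UFS). Then either $\mathfrak{S}$ is an integral domain or it is additively reduced.
   Context: A semidomain is a subset of an integral domain that contains $0$ and $1$ and is closed under addition and multiplication (with the inherited operations). For a semidomain $\mathfrak{S}$, $\mathfrak{S}^* = \mathfrak{S}\setminus\{0\}$ is a cancellative commutative monoid under multiplication. An atom is a nonunit $a\in\mathfrak{S}^*$ such that $a=bc$ with $b,c\in\mathfrak{S}^*$ implies $b$ or $c$ is a unit of $\mathfrak{S}^*$. $\mathfrak{S}$ is a unique factorization semidomain (UFS) if $\mathfrak{S}^*$ is a unique factorization (factorial) monoid: every nonunit of $\mathfrak{S}^*$ is a finite product of atoms, and every element of $\mathfrak{S}^*$ has a unique factorization into atoms up to order and associates; equivalently, every nonzero nonunit element is a product of finitely many prime elements. $\mathfrak{S}$ is additively reduced if $0$ is the only element of $\mathfrak{S}$ having an additive inverse in $\mathfrak{S}$. *)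

(* Defs.v *)
From HB Require Import structures.
From mathcomp Require Import all_boot all_order all_algebra.
From mathcomp Require Import boolp classical_sets.

Set Implicit Arguments.
Unset Strict Implicit.
Unset Printing Implicit Defensive.

Import GRing.Theory.
Local Open Scope ring_scope.

Definition is_semidomain (R : idomainType) (S : set R) : Prop :=
  GRing.semiring_closed (mem S).

(* [GRing.subring_closed] says that the inherited operations make S a ring;
   commutativity is inherited from R. *)
Definition is_integral_domain (R : idomainType) (S : set R) : Prop :=
  [/\ GRing.subring_closed (mem S),
      (1 : R) <> 0 &
      forall x y : R, x \in S -> y \in S -> x * y = 0 -> x = 0 \/ y = 0].

Definition additively_reduced (R : idomainType) (S : set R) : Prop :=
  forall x : R, x \in S -> (exists2 y : R, y \in S & x + y = 0) -> x = 0.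

Definition nonzero_elts (R : idomainType) (S : set R) : set R :=
  [set x | x \in S /\ x <> 0]%classic.

(* Invertibility is relative to the monoid of nonzero elements of S, not to
   the ambient ring: [GRing.unit] would be wrong here. *)
Definition sd_unit (R : idomainType) (S : set R) (u : R) : Prop :=
  u \in nonzero_elts S /\ exists2 v : R, v \in nonzero_elts S & u * v = 1.

Definition sd_atom (R : idomainType) (S : set R) (a : R) : Prop :=
  [/\ a \in nonzero_elts S,
      ~ sd_unit S a &
      forall b c : R, b \in nonzero_elts S -> c \in nonzero_elts S ->
        a = b * c -> sd_unit S b \/ sd_unit S c].

Definition sd_associate (R : idomainType) (S : set R) (a b : R) : Prop :=
  exists2 u : R, sd_unit S u & a = u * b.

Definition sd_factorization (R : idomainType) (S : set R) (x : R) (s : seq R)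
    : Prop :=
  (forall a : R, a \in s -> sd_atom S a) /\ x = \prod_(a <- s) a.

Definition same_factorization (R : idomainType) (S : set R) (s t : seq R)
    : Prop :=
  exists t' : seq R,
    [/\ perm_eq t t', size s = size t' &
        forall i : nat, (i < size s)%N -> sd_associate S s`_i t'`_i].

(* Units are covered by the uniqueness clause too: their only factorization
   is the empty one. *)
Definition is_UFS (R : idomainType) (S : set R) : Prop :=
  [/\ is_semidomain S,
      forall x : R, x \in nonzero_elts S -> ~ sd_unit S x ->
        exists s : seq R, sd_factorization S x s &
      forall (x : R) (s t : seq R), x \in nonzero_elts S ->
        sd_factorization S x s -> sd_factorization S x t ->
        same_factorization S s t].

(* Main.v *)
(** If both [x] and [-x] are nonzero elements of S, then [x ^ 2 = (- x) ^ 2], so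
    comparing multiplicities of atoms shows that [x] and [-x] are associates in
    S; cancelling [x], the unit relating them is [-1], which thus lies in S. *)
Require Import Defs.
From HB Require Import structures.
From mathcomp Require Import all_boot all_order all_algebra.
From mathcomp Require Import boolp classical_sets.

Set Implicit Arguments.
Unset Strict Implicit.
Unset Printing Implicit Defensive.

Import GRing.Theory.
Local Open Scope ring_scope.

Lemma nonzero_eltsP (R : idomainType) (S : set R) (x : R) :
  x \in nonzero_elts S <-> x \in S /\ x <> 0.
Proof. by rewrite in_setE. Qed.

Lemma nonzero_eltsM (R : idomainType) (S : set R) (x y : R) :
  is_semidomain S -> x \in nonzero_elts S -> y \in nonzero_elts S ->
  x * y \in nonzero_elts S.
Proof.
move=> [_ [_ SM]] /nonzero_eltsP[Sx /eqP x0] /nonzero_eltsP[Sy /eqP y0].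
by apply/nonzero_eltsP; split; [exact: SM | apply/eqP; rewrite mulf_neq0].
Qed.

Lemma sd_unit1 (R : idomainType) (S : set R) : is_semidomain S -> sd_unit S 1.
Proof.
move=> [_ [S1 _]].
have N1 : (1 : R) \in nonzero_elts S.
  by apply/nonzero_eltsP; split=> //; apply/eqP/oner_neq0.
by split=> //; exists 1; rewrite ?mulr1.
Qed.

Lemma sd_unitM (R : idomainType) (S : set R) (u v : R) :
  is_semidomain S -> sd_unit S u -> sd_unit S v -> sd_unit S (u * v).
Proof.
move=> sdS [Nu [u' Nu' uu']] [Nv [v' Nv' vv']].
split; first exact: nonzero_eltsM.
exists (u' * v'); first exact: nonzero_eltsM.
by rewrite mulrACA uu' vv' mulr1.
Qed.

Lemma sd_associate_refl (R : idomainType) (S : set R) (a : R) :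
  is_semidomain S -> sd_associate S a a.
Proof. by move=> sdS; exists 1; [exact: sd_unit1 | rewrite mul1r]. Qed.

Lemma sd_associate_sym (R : idomainType) (S : set R) (a b : R) :
  sd_associate S a b -> sd_associate S b a.
Proof.
move=> [u [Nu [v Nv uv]] ->]; exists v; last by rewrite mulrA (mulrC v) uv mul1r.
by split=> //; exists u; rewrite // mulrC.
Qed.

Lemma sd_associate_trans (R : idomainType) (S : set R) (a b c : R) :
  is_semidomain S -> sd_associate S a b -> sd_associate S b c ->
  sd_associate S a c.
Proof.
move=> sdS [u Uu ->] [v Uv ->].
by exists (u * v); [exact: sd_unitM | rewrite mulrA].
Qed.

Lemma sd_associateM (R : idomainType) (S : set R) (a b c d : R) :
  is_semidomain S -> sd_associate S a b -> sd_associate S c d ->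
  sd_associate S (a * c) (b * d).
Proof.
move=> sdS [u Uu ->] [v Uv ->].
by exists (u * v); [exact: sd_unitM | rewrite mulrACA].
Qed.

(** Classical reflection makes association a boolean predicate, so that [count (associateb S p) s]
    is the multiplicity of [p] in [s] up to units. *)
Definition associateb (R : idomainType) (S : set R) (p : R) : pred R :=
  fun a => `[< sd_associate S p a >].

Lemma associatebE (R : idomainType) (S : set R) (p a b : R) :
  is_semidomain S -> sd_associate S a b ->
  associateb S p a = associateb S p b.
Proof.
move=> sdS ab; apply/asboolP/asboolP => pa.
  exact: sd_associate_trans pa ab.
exact: sd_associate_trans pa (sd_associate_sym ab).
Qed.

(** Multiplicities are invariant under permutation, and replacing an entry by an associate does not
    change whether it is associated to [p]. *)
Lemma same_factorization_count (R : idomainType) (S : set R) (s t : seq R)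
    (p : R) :
  is_semidomain S -> same_factorization S s t ->
  count (associateb S p) s = count (associateb S p) t.
Proof.
move=> sdS [t' [/permP -> sz st']].
elim: s t' sz st' => [|a s IHs] [|b t'] //= [sz] st'.
rewrite (associatebE p sdS (st' 0%N isT)) (IHs t') // => i.
exact: (st' i.+1).
Qed.

(** Induction on [s]: its head [p] has positive multiplicity, so some [q] in [t] is associated to
    [p]; both are removed and the remaining products compared. *)
Lemma associate_prod (R : idomainType) (S : set R) (s t : seq R) :
  is_semidomain S ->
  (forall p, count (associateb S p) s = count (associateb S p) t) ->
  sd_associate S (\prod_(a <- s) a) (\prod_(a <- t) a).
Proof.
move=> sdS; have refl p : associateb S p p by apply/asboolP/sd_associate_refl.
elim: s t => [|p s IHs] t st.
  (* With [s] empty, [t] is empty as well: a head [q] would be counted as its own associate. *)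
  case: t st => [_ | q t /(_ q)]; first by rewrite !big_nil; exact: sd_associate_refl.
  by rewrite /= refl.
have /hasP[q tq /asboolP pq] : has (associateb S p) t.
  by rewrite has_count -st /= refl.
rewrite (perm_big _ (perm_to_rem tq)) !big_cons.
apply: sd_associateM => //; apply: IHs => r; apply/eqP.
(* Since [p] and [q] are associated, they contribute equally to the count for [r], so removing them
   keeps the multiplicities equal. *)
rewrite -(eqn_add2l (associateb S r p)) {2}(associatebE r sdS pq).
by have := st r; rewrite (permP (perm_to_rem tq)) /= => ->.
Qed.

Lemma unit_opp_mem (R : idomainType) (S : set R) (x : R) :
  is_semidomain S -> sd_unit S x -> - x \in S -> -1 \in S.
Proof.
move=> [_ [_ SM]] [_ [v /nonzero_eltsP[Sv _] xv]] SNx.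
by rewrite -xv -mulNr; apply: SM.
Qed.

Lemma UFS_opp_mem (R : idomainType) (S : set R) (x : R) :
  is_UFS S -> x \in S -> - x \in S -> x <> 0 -> -1 \in S.
Proof.
move=> [sdS factS uniqS] Sx SNx x0.
have Nx : x \in nonzero_elts S by apply/nonzero_eltsP.
have NNx : - x \in nonzero_elts S.
  by apply/nonzero_eltsP; split=> // /eqP; rewrite oppr_eq0 => /eqP.
(* Factorizations are provided for nonunits only, so the cases where [x] or [- x] is a unit are
   settled directly. *)
have [/unit_opp_mem|nUx] := pselect (sd_unit S x); first exact.
have [/unit_opp_mem|nUNx] := pselect (sd_unit S (- x)).
  by rewrite opprK; exact.
have [s [atom_s xs]] := factS _ Nx nUx.
have [t [atom_t xt]] := factS _ NNx nUNx.
have [] : sd_associate S (- x) x; last first.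
  move=> u [/nonzero_eltsP[Su _] _] NxE; suff -> : -1 = u by [].
  by apply: (mulIf (introN eqP x0)); rewrite mulN1r.
rewrite {1}xt xs; apply: associate_prod => // p.
(* Both lists factor [x * x], so uniqueness applies; each multiplicity is doubled, and halving gives
   the equality for [t] and [s]. *)
have : same_factorization S (t ++ t) (s ++ s).
  apply: (uniqS (x * x)); first exact: nonzero_eltsM.
    split; first by move=> a; rewrite mem_cat orbb => /atom_t.
    by rewrite big_cat /= -xt mulrNN.
  split; first by move=> a; rewrite mem_cat orbb => /atom_s.
  by rewrite big_cat /= -xs.
move/(same_factorization_count p sdS).
by rewrite !count_cat !addnn => /double_inj.
Qed.

Theorem proposition4p5 (R : idomainType) (S : set R) :
  is_UFS S -> is_integral_domain S \/ additively_reduced S.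
Proof.
move=> ufsS; have [[[S0 SD] [S1 SM]] _ _] := ufsS.
(* If [-1] lies in [S], then [S] is closed under subtraction, as [x - y = x + (-1) * y]. Otherwise
   no nonzero element of [S] has its opposite in [S]. *)
have [SN1|nSN1] := pselect (-1 \in S); [left | right].
  split; last 2 first.
  - exact/eqP/oner_neq0.
  - by move=> x y _ _ /eqP; rewrite mulf_eq0 => /orP[] /eqP; [left | right].
  split=> // x y Sx Sy.
  by rewrite -mulN1r; apply: SD => //; apply: SM.
move=> x Sx [y Sy /eqP]; rewrite addrC addr_eq0 => /eqP yE.
apply: contrapT => x0; apply: nSN1.
by apply: (UFS_opp_mem ufsS Sx) => //; rewrite -yE.
Qed.
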